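(* Let $m,b$ be positive integers and let $\mathcal{A}=\{a_1,\ldots,a_n\}$ be a Sidon set (with $n$ elements) in the additive group $\mathbb{Z}_{mb}$. If $\mathcal{A}\bmod b:=\{a\bmod b : a\in\mathcal{A}\}=[1,n]$, then the function $f:[1,n]\to\mathbb{Z}_m$ defined by $$f(i)=\left\lfloor\frac{a_i}{b}\right\rfloor,$$ where $a_i$ is the unique element of $\mathcal{A}$ such that $a_i\equiv i\pmod b$, is an $m\times n$ modular sonar sequence.
   Context: $[1,n]$ denotes the finite set $\{1,2,\ldots,n\}$. $\mathbb{Z}_N$ is the additive group of integers modulo $N$. Elements of $\mathbb{Z}_{mb}$ are represented by integers when forming $\lfloor a_i/b\rfloor$, and the result is taken modulo $m$ (changing the representative by a multiple of $mb$ changes $\lfloor a_i/b\rfloor$ by a multiple of $m$). The condition $\mathcal{A}\bmod b=[1,n]$ says that the residues modulo $b$ of the elements of $\mathcal{A}$ are exactly those of $1,\ldots,n$; the case $n=b$, in which the residue class of $0$ is represented by $b$, is allowed. $\lfloor y\rfloor$ denotes the largest integer less than or equal to $y$. Sidon set: a subset $\mathcal{A}=\{a_1,\ldots,a_k\}$ of a finite abelian group $(G,+)$ is a Sidon set in $G$ if every $x\in G$ can be written in at most one way as $x=a_i+a_j$ with $1\le i\le j\le k$; equivalently, for all $a,b,c,d\in\mathcal{A}$, $a+b=c+d$ implies $\{a,b\}=\{c,d\}$. Modular sonar sequence: an $m\times n$ modular sonar sequence is a function $f:[1,n]\to\mathbb{Z}_m$ such that for all integers $h,i,j$ with $1\le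 h\le n-1$ and $1\le i,j\le n-h$, $f(i+h)-f(i)\equiv f(j+h)-f(j)\pmod m$ implies $i=j$.
   Formalization: The claim with f(i)=⌊a_i/b⌋ is proved for n<b, since it fails for n=b (m=5, b=3, A={1,5,6}); for all n≤b it is proved with f(i) the quotient of a_i by b with remainder in {1,…,b}, i.e. ⌊a_b/b⌋−1 at i=b. *)

(* Defs.v *)
(* MathComp world. *)
From HB Require Import structures.
From mathcomp Require Import all_boot all_order all_algebra.

Set Implicit Arguments.
Unset Strict Implicit.
Unset Printing Implicit Defensive.

Import GRing.Theory.

Local Open Scope nat_scope.

(* The additive group of integers modulo N, for every N >= 1, including N = 1,
   where ['Z_N] would have two elements.  Its elements are carried by the
   representatives 0, ..., N - 1, and [inZp : nat -> Zmod N] is reduction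
   modulo N. *)
Notation Zmod N := 'I_N.-1.+1.

Definition Sidon (G : finZmodType) (A : {set G}) : Prop :=
  forall a b c d : G, a \in A -> b \in A -> c \in A -> d \in A ->
    (a + b = c + d)%R -> [set a; b] = [set c; d].

(* The residue of x modulo b taken in {1, ..., b}: the class of 0 is
   represented by b. *)
Definition residue1 (b x : nat) : nat := if b %| x then b else x %% b.

(* The integer part of x / b, modulo m.  If x, y represent the same element of
   Z_(m b), the results agree, so the representative 0 <= x < m b may be used. *)
Definition floor_div (m b x : nat) : Zmod m := inZp (x %/ b).

(* The quotient q, modulo m, in x = q b + r with r = residue1 b x.  It is
   floor_div m b x unless b %| x, where r = b and q = x / b - 1.
   The two differ only on the residue class of 0, but there it matters:
   {1, 5, 6} is a Sidon set in Z_15 with residues 1, 2, 3 modulo 3, and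
   i |-> floor (a_i / 3) is i |-> i - 1, which is not a 5 x 3 modular sonar
   sequence. *)
Definition quotient1 (m b x : nat) : Zmod m :=
  (floor_div m b x - inZp (b %| x))%R.

(* A function on {1, ..., n} is given by a function on nat, of which only the
   values at 1, ..., n are used. *)
Definition modular_sonar (m n : nat) (f : nat -> Zmod m) : Prop :=
  forall h i j : nat,
    1 <= h <= n - 1 -> 1 <= i <= n - h -> 1 <= j <= n - h ->
    (f (i + h) - f i = f (j + h) - f j)%R -> i = j.

(* Main.v *)
Require Import Defs.
From HB Require Import structures.
From mathcomp Require Import all_boot all_order all_algebra.

(** Write an element [a] of [Z_(m b)] as [b q + r], where [r] in [{1, ..., b}]
    is its residue.  Multiplication by [b] is a well-defined additive map from
    [Z_m] to [Z_(m b)], so [q] is only needed modulo [m], that is, [a] is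
    determined by its [quotient1] and its [residue1] ([scaleZp_residue1]).
    Since [A] has as many elements as residues, these residues index [A]
    ([residue1_inj]), and [a_i] is the image of [f i] plus [i].

    A repeated difference [f (i + h) - f i = f (j + h) - f j] rearranges to
    [f (i + h) + f j = f (j + h) + f i].  Taking images in [Z_(m b)] and adding
    the same integer [i + j + h] to both sides gives
    [a_(i + h) + a_j = a_(j + h) + a_i].  By the Sidon property [a_(i + h)] is
    [a_(j + h)] or [a_i]; the latter is excluded by [h >= 1], and the former
    gives [i = j].

    When [n < b] no element of [A] is divisible by [b], so the plain integer
    part agrees with [quotient1] on [A]. *)

Set Implicit Arguments.
Unset Strict Implicit.
Unset Printing Implicit Defensive.

Import GRing.Theory.

Local Open Scope nat_scope.

Lemma inZpD p x y : (inZp (x + y) = inZp x + inZp y :> 'I_p.+1)%R.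
Proof. by apply: val_inj; rewrite /= modnDm. Qed.

Lemma residue1E b x : residue1 b x = x %% b + b * (b %| x).
Proof.
rewrite /residue1 /dvdn; case: eqP => [->|_].
  by rewrite muln1.
by rewrite muln0 addn0.
Qed.

Lemma residue1_mod b x : residue1 b x = x %[mod b].
Proof. by rewrite residue1E mulnC addnC modnMDl modn_mod. Qed.

Lemma residue1_bounds b x : 0 < b -> 0 < residue1 b x <= b.
Proof.
move=> b_gt0; rewrite /residue1; case: ifP => [_|/negbT].
  by rewrite b_gt0 leqnn.
by rewrite /dvdn -lt0n => ->; rewrite ltnW ?ltn_mod.
Qed.

Lemma residue1_small b i : 0 < i <= b -> residue1 b i = i.
Proof.
case/andP=> i_gt0; rewrite leq_eqVlt /residue1 => /orP[/eqP->|lt_ib].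
  by rewrite dvdnn.
by rewrite gtnNdvd // modn_small.
Qed.

Lemma eq_residue1 b x y : x = y %[mod b] -> residue1 b x = residue1 b y.
Proof. by rewrite !residue1E /dvdn => ->. Qed.

(** Changing [x] by a multiple of [m] changes [b x] by a multiple of [m b], so
    reducing modulo [m] before scaling loses nothing ([scaleZp_inZp]). *)
Definition scaleZp (m b : nat) (x : Zmod m) : Zmod (m * b) := inZp (b * x).

Section Scale.

Variables m b : nat.
Hypotheses (m_gt0 : 0 < m) (b_gt0 : 0 < b).

Lemma scaleZp_inZp x : scaleZp b (inZp x : Zmod m) = inZp (b * x).
Proof.
apply: val_inj; rewrite /= !prednK ?muln_gt0 ?m_gt0 //.
by rewrite muln_modr [b * m]mulnC modn_mod.
Qed.

Lemma scaleZpD (x y : Zmod m) :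
  (scaleZp b (x + y) = scaleZp b x + scaleZp b y)%R.
Proof.
by rewrite -[x]valZpK -[y]valZpK -inZpD !scaleZp_inZp mulnDr inZpD.
Qed.

(** Euclidean division with remainders in [{1, ..., b}], read in [Z_(m b)]. *)
Lemma scaleZp_residue1 (a : Zmod (m * b)) :
  (scaleZp b (quotient1 m b a) + inZp (residue1 b a) = a)%R.
Proof.
(* When [b %| a] the remainder is [b] instead of 0; it cancels the scaled 1
   subtracted in [quotient1]. *)
rewrite residue1E addnC inZpD -scaleZp_inZp addrA -scaleZpD subrK.
by rewrite scaleZp_inZp -inZpD [b * _]mulnC -divn_eq valZpK.
Qed.

End Scale.

Lemma floor_div_quotient1 m b x :
  ~~ (b %| x) -> floor_div m b x = quotient1 m b x.
Proof.
move=> /negbTE nb_x; rewrite /quotient1 nb_x.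
have -> : inZp false = 0%R :> Zmod m by apply: val_inj; rewrite /= mod0n.
by rewrite subr0.
Qed.

Section ResidueIndexing.

Variables (m b n : nat) (A : {set Zmod (m * b)}).
Hypotheses (m_gt0 : 0 < m) (b_gt0 : 0 < b) (cardA : #|A| = n).
Hypothesis A_mod_b : [seq residue1 b (nat_of_ord a) | a in A] =i iota 1 n.

(** The list of residues of [A] has [n] entries and the same members as the
    duplicate-free list [1, ..., n], so it has no repetition. *)
Lemma residue1_inj : {in A &, injective (fun a => residue1 b (nat_of_ord a))}.
Proof.
apply/dinjectiveP; rewrite /dinjectiveb.
rewrite (@eq_uniq _ _ (iota 1 n)) ?iota_uniq //.
by rewrite size_map -cardE size_iota.
Qed.

Lemma index_bounds i : 1 <= i <= n -> exists2 a, a \in A & residue1 b a = i.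
Proof.
move=> i_n; have : i \in iota 1 n by rewrite mem_iota add1n ltnS.
by rewrite -A_mod_b => /imageP[a aA ->]; exists a.
Qed.

Lemma index_le i : 1 <= i <= n -> 0 < i <= b.
Proof. by case/index_bounds => a _ <-; apply: residue1_bounds. Qed.

Lemma residue1_index i x : 1 <= i <= n -> x = i %[mod b] -> residue1 b x = i.
Proof. by move=> /index_le i_b /eq_residue1 ->; apply: residue1_small. Qed.

Lemma unique_representative i : 1 <= i <= n ->
  exists! a : Zmod (m * b), a \in A /\ nat_of_ord a = i %[mod b].
Proof.
move=> i_n; have [a aA a_i] := index_bounds i_n.
exists a; split; first by split; rewrite // -residue1_mod a_i.
move=> c [cA c_i]; apply: residue1_inj => //.
by rewrite a_i (residue1_index i_n c_i).
Qed.

Hypothesis sidonA : Sidon A.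

Lemma Sidon_modular_sonar (f : nat -> Zmod m) :
  (forall (i : nat) (a : Zmod (m * b)), 1 <= i <= n ->
     a \in A -> nat_of_ord a = i %[mod b] -> f i = quotient1 m b a) ->
  modular_sonar n f.
Proof.
move=> fE h i j /andP[h_gt0 h_n] /andP[i_gt0 i_n] /andP[j_gt0 j_n] eq_diff.
have h_le_n : h <= n by rewrite (leq_trans h_n) ?leq_subr.
have rep k : 1 <= k <= n ->
    exists a, [/\ a \in A, residue1 b a = k & (scaleZp b (f k) + inZp k = a)%R].
  move=> k_n; have [a aA a_k] := index_bounds k_n; exists a; split=> //.
  rewrite (fE k a) // -?[X in inZp X]a_k ?scaleZp_residue1 //.
  by rewrite -a_k residue1_mod.
have shift k : 0 < k -> k <= n - h -> (1 <= k <= n) && (1 <= k + h <= n).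
  move=> k_gt0 k_n; rewrite k_gt0 addn_gt0 k_gt0 /=.
  by rewrite (leq_trans k_n) ?leq_subr //= -(subnK h_le_n) leq_add2r.
have /andP[/rep[ai [aiA ri Ei]] /rep[aih [aihA rih Eih]]] := shift i i_gt0 i_n.
have /andP[/rep[aj [ajA rj Ej]] /rep[ajh [ajhA rjh Ejh]]] := shift j j_gt0 j_n.
have eq_f : (f (i + h) + f j = f (j + h) + f i)%R.
  by apply/eqP; rewrite addrC -subr_eq -addrA eq_diff addrCA subrr addr0.
have eq_sum : (aih + aj = ajh + ai)%R.
  rewrite -Eih -Ej -Ejh -Ei addrACA [RHS]addrACA -!scaleZpD // -!inZpD.
  by rewrite eq_f addnAC [i + j]addnC addnAC.
have : aih \in [set ajh; ai].
  by rewrite -(sidonA aihA ajA ajhA aiA eq_sum) set21.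
rewrite !inE => /orP[]/eqP eq_a.
  (* Equal elements have equal residues: [i + h = j + h] here, and
     [i + h = i] in the other case. *)
  by apply: (@addIn h); rewrite -rih eq_a.
by have := ltnn i; rewrite -{2}ri -eq_a rih -[X in X < _]addn0 ltn_add2l h_gt0.
Qed.

End ResidueIndexing.

Theorem theorem10 (m b n : nat) (A : {set Zmod (m * b)})
    (m_gt0 : 0 < m) (b_gt0 : 0 < b)
    (cardA : #|A| = n) (sidonA : Sidon A)
    (A_mod_b : [seq residue1 b (nat_of_ord a) | a in A] =i iota 1 n) :
  [/\ forall i : nat, 1 <= i <= n ->
        exists! a : Zmod (m * b), a \in A /\ nat_of_ord a = i %[mod b],
      n < b ->
        forall f : nat -> Zmod m,
        (forall (i : nat) (a : Zmod (m * b)), 1 <= i <= n ->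
           a \in A -> nat_of_ord a = i %[mod b] ->
           f i = floor_div m b (nat_of_ord a)) ->
        modular_sonar n f
    & forall f : nat -> Zmod m,
        (forall (i : nat) (a : Zmod (m * b)), 1 <= i <= n ->
           a \in A -> nat_of_ord a = i %[mod b] ->
           f i = quotient1 m b (nat_of_ord a)) ->
        modular_sonar n f].
Proof.
split=> [|n_lt_b f fE|].
- exact: unique_representative.
- apply: (Sidon_modular_sonar (A := A)) => // i a i_n aA a_i.
  rewrite (fE i a) // floor_div_quotient1 //.
  have /andP[i_gt0 i_le_n] := i_n.
  by rewrite /dvdn a_i -/(b %| i) gtnNdvd // (leq_ltn_trans i_le_n).
- exact: Sidon_modular_sonar.
Qed.
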